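(* Let $X$ be a real Banach space with $\dim X\ge 2$ and let $0<\lambda\le 1$. Then $$J_\lambda^\perp(X)\le\min\left\{1,\ \lambda\left(1+\rho_X\!\left(\frac{1-\lambda}{\lambda}\right)\right)\right\}.$$ In particular, for $\lambda=\frac12$, $$J_{1/2}^\perp(X)\le\frac{1+\rho_X(1)}{2}.$$
   Context: For a real Banach space $X$, $S_X=\{x\in X:\|x\|=1\}$. For $x,y\in X$, $x\perp_B y$ (Birkhoff--James orthogonality) means $\|x\|\le\|x+ty\|$ for every $t\in\mathbb R$. For $\lambda\in[0,1]$, $$J_\lambda^\perp(X)=\sup\{\min\{\|\lambda x+(1-\lambda)y\|,\|\lambda x-(1-\lambda)y\|\}: x,y\in S_X,\ x\perp_B y\}.$$ The modulus of smoothness of $X$ is, for $t\ge0$, $$\rho_X(t)=\sup\left\{\frac{\|x+ty\|+\|x-ty\|}{2}-1: x,y\in S_X\right\}.$$ *)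

(* Defs.v *)
From HB Require Import structures.
From mathcomp Require Import all_boot all_order all_algebra.
From mathcomp Require Import all_classical all_reals all_analysis.

Set Implicit Arguments.
Unset Strict Implicit.
Unset Printing Implicit Defensive.

Import Order.TTheory GRing.Theory Num.Theory.
Import numFieldNormedType.Exports.

Local Open Scope classical_set_scope.
Local Open Scope ring_scope.

Definition unit_sphere (R : realType) (X : normedModType R) : set X :=
  [set x | `|x| = 1].

Definition birkhoff_orth (R : realType) (X : normedModType R) (x y : X) : Prop :=
  forall t : R, `|x| <= `|x + t *: y|.

(* [sup] is 0 on sets that are empty or unbounded above.  The sets below are
   bounded, and nonempty as soon as X has dimension at least 2. *)
Definition Jperp (R : realType) (X : normedModType R) (lambda : R) : R :=
  sup [set r : R | exists x y : X,
    [/\ unit_sphere x, unit_sphere y, birkhoff_orth x y &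
        r = Num.min `|lambda *: x + (1 - lambda) *: y|
                    `|lambda *: x - (1 - lambda) *: y| ] ].

Definition modulus_smoothness (R : realType) (X : normedModType R) (t : R) : R :=
  sup [set r : R | exists x y : X,
    [/\ unit_sphere x, unit_sphere y &
        r = (`|x + t *: y| + `|x - t *: y|) / 2 - 1 ] ].

(* Two linearly independent vectors; [vectType]'s dimension is not usable,
   since X may be infinite-dimensional. *)
Definition dim_ge2 (R : realType) (X : normedModType R) : Prop :=
  exists u v : X, forall a b : R, a *: u + b *: v = 0 -> a = 0 /\ b = 0.

Arguments unit_sphere {R} X.
Arguments Jperp {R} X lambda.
Arguments modulus_smoothness {R} X t.
Arguments dim_ge2 {R} X.

(* Main.v *)
Require Import Defs.
From HB Require Import structures.
From mathcomp Require Import all_boot all_order all_algebra.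
From mathcomp Require Import all_classical all_reals all_analysis.
From mathcomp Require Import ring lra.

Set Implicit Arguments.
Unset Strict Implicit.
Unset Printing Implicit Defensive.

Import Order.TTheory GRing.Theory Num.Theory.
Import numFieldNormedType.Exports.

Local Open Scope ring_scope.

(** Put [t = (1 - lambda) / lambda], so that
    [`|lambda *: x +- (1 - lambda) *: y| = lambda * `|x +- t *: y|].
    The minimum of these two norms is at most their average, which is
    [lambda] times [(`|x + t *: y| + `|x - t *: y|) / 2], and the latter is at
    most [1 + modulus_smoothness X t] because the supremum defining the modulus
    runs over a set bounded above by [`|t|]
    ([smoothness_quotient_le_modulus]).  The bound by [1] is the triangle
    inequality with the convex weights [lambda] and [1 - lambda].

    These pointwise bounds give the bound on [Jperp] when the set of minima is
    nonempty.  On the empty set [sup] is [0], and the right-hand side is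
    nonnegative because the modulus of smoothness is
    ([modulus_smoothness_ge0]); so the existence of Birkhoff--James orthogonal
    unit vectors never has to be established. *)

Lemma exists_unit_vector (R : realType) (X : normedModType R) :
  dim_ge2 X -> exists x : X, unit_sphere X x.
Proof.
move=> [u [v uv_free]]; have u_neq0 : u != 0.
  apply/eqP => u0; have [|/eqP] := uv_free 1 0.
    by rewrite u0 scaler0 scale0r addr0.
  by rewrite oner_eq0.
by exists (`|u|^-1 *: u); rewrite /unit_sphere /= normrZV ?unitfE ?normr_eq0.
Qed.

(** Since [sup] is [0] on sets unbounded above, boundedness has to be checked:
    the triangle inequality provides the upper bound [`|t|]. *)
Lemma smoothness_quotient_le_modulus (R : realType) (X : normedModType R)
    (t : R) (x y : X) :
  unit_sphere X x -> unit_sphere X y ->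
  (`|x + t *: y| + `|x - t *: y|) / 2 - 1 <= modulus_smoothness X t.
Proof.
move=> x1 y1; apply: ub_le_sup; last by exists x, y.
exists `|t| => _ [a [b [a1 b1 ->]]].
have := ler_normD a (t *: b); have := ler_normB a (t *: b).
rewrite normrZ a1 b1; lra.
Qed.

(** The average of [`|x + t *: y|] and [`|x - t *: y|] is at least [`|x|] for
    all [y], so any pair of unit vectors is a witness; the proof uses the pair
    [(x, x)]. *)
Lemma modulus_smoothness_ge0 (R : realType) (X : normedModType R) (t : R) :
  dim_ge2 X -> 0 <= modulus_smoothness X t.
Proof.
move=> /exists_unit_vector[x x1].
apply: le_trans (smoothness_quotient_le_modulus t x1 x1).
have := ler_normD (x + t *: x) (x - t *: x).
rewrite addrCA addrK -mulr2n normrMn x1; lra.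
Qed.

(** Homogeneity of the norm.  The coefficient [s], meant to be [1] or [-1],
    covers both signs at once, turning the convex combinations in [Jperp] into
    the vectors [x +- t *: y]. *)
Lemma norm_convex_combination (R : realType) (X : normedModType R)
    (lambda s : R) (x y : X) : 0 < lambda ->
  `|lambda *: x + (s * (1 - lambda)) *: y| =
  lambda * `|x + (s * ((1 - lambda) / lambda)) *: y|.
Proof.
move=> lambda_gt0; rewrite -{3}(gtr0_norm lambda_gt0) -normrZ scalerDr scalerA.
by congr (`| _ + _ *: _|); field; rewrite gt_eqF.
Qed.

Lemma Jperp_le_modulus (R : realType) (X : normedModType R) (lambda : R) :
  dim_ge2 X -> 0 < lambda -> lambda <= 1 ->
  Jperp X lambda <=
    Num.min 1 (lambda * (1 + modulus_smoothness X ((1 - lambda) / lambda))).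
Proof.
move=> hdim lambda_gt0 lambda_le1; set t := (1 - lambda) / lambda.
rewrite /Jperp; set S := (X in sup X).
have [->|/set0P S_neq0] := eqVneq S set0.
  rewrite sup0 le_min ler01 /= mulr_ge0 ?(ltW lambda_gt0)//.
  by rewrite addr_ge0 ?modulus_smoothness_ge0.
apply: ge_sup => // _ [x [y [x1 y1 _ ->]]].
have plus_le1 : `|lambda *: x + (1 - lambda) *: y| <= 1.
  apply: le_trans (ler_normD _ _) _.
  by rewrite !normrZ x1 y1 !mulr1 !ger0_norm ?subr_ge0 ?subrKC // ltW.
have plusE : `|lambda *: x + (1 - lambda) *: y| = lambda * `|x + t *: y|.
  by have := norm_convex_combination 1 x y lambda_gt0; rewrite !mul1r.
have minusE : `|lambda *: x - (1 - lambda) *: y| = lambda * `|x - t *: y|.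
  by have := norm_convex_combination (-1) x y lambda_gt0; rewrite !mulN1r !scaleNr.
rewrite le_min; apply/andP; split; first by rewrite ge_min plus_le1.
rewrite plusE minusE -minr_pMr ?(ltW lambda_gt0)// ler_pM2l//.
have := smoothness_quotient_le_modulus t x1 y1.
have : Num.min `|x + t *: y| `|x - t *: y| <= `|x + t *: y|.
  by rewrite ge_min lexx.
have : Num.min `|x + t *: y| `|x - t *: y| <= `|x - t *: y|.
  by rewrite ge_min lexx orbT.
lra.
Qed.

Theorem proposition3p17 (R : realType) (X : completeNormedModType R)
    (hdim : dim_ge2 X) :
  (forall lambda : R, 0 < lambda -> lambda <= 1 ->
     Jperp X lambda <=
       Num.min 1 (lambda * (1 + modulus_smoothness X ((1 - lambda) / lambda))))
  /\ Jperp X (1 / 2) <= (1 + modulus_smoothness X 1) / 2.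
Proof.
split=> [lambda|]; first exact: Jperp_le_modulus.
have half_gt0 : (0 : R) < 1 / 2 by lra.
have half_le1 : (1 / 2 : R) <= 1 by lra.
have := Jperp_le_modulus hdim half_gt0 half_le1.
have -> : (1 - 1 / 2) / (1 / 2) = 1 :> R by field.
by rewrite le_min => /andP[_]; rewrite mul1r mulrC.
Qed.
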